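(* Let $TM=D\oplus D^{\bot}$ with $\dim D=n\geq 2$, and let $M$ be a Riemannian manifold of constant sectional curvature $c$ endowed with the semi-symmetric non-metric connection $\widehat{\nabla}$. Then for every unit vector field $X\in\Gamma(D)$, $$\widehat{\mathrm{Ric}}^D(X)\leq (n-1)c-\lambda_1+\alpha_1(X,X)-n\,\omega(H)+\omega(B(X,X))+\frac{n^2}{4}\|H\|^2+\frac{\|B^X\|^2}{2}+A^D(X).$$
   Context: $(M,g)$ is a smooth Riemannian manifold with Levi-Civita connection $\nabla$. $D\subseteq TM$ is a smooth subbundle (distribution) of constant rank $n$ that is non integrable, i.e. there are $X,Y\in\Gamma(D)$ with $[X,Y]\notin\Gamma(D)$. $D^\bot$ is its orthogonal complement, $\pi^D:TM\to D$ and $\pi^{D^\bot}:TM\to D^\bot$ are the orthogonal projections, $[X,Y]^D=\pi^D[X,Y]$, $[X,Y]^{D^\bot}=\pi^{D^\bot}[X,Y]$. For $X,Y\in\Gamma(D)$, $B(X,Y)=\pi^{D^\bot}(\nabla_XY)$. $U$ is a vector field on $M$, $\omega(V)=g(U,V)$. The semi-symmetric non-metric connection on $M$ is $\widehat\nabla_XY=\nabla_XY+\omega(Y)X$. For $X,Y\in\Gamma(D)$ put $\widehat\nabla^D_XY=\pi^D(\widehat\nabla_XY)$ and $$\widehat R^D(X,Y)Z=\widehat\nabla^D_X\widehat\nabla^D_YZ-\widehat\nabla^D_Y\widehat\nabla^D_XZ-\widehat\nabla^D_{[X,Y]^D}Z-\pi^D[[X,Y]^{D^\bot},Z],$$ with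 $\widehat R^D(X,Y,Z,W)=g(\widehat R^D(X,Y)Z,W)$. Given a unit $X\in\Gamma(D)$, let $\{E_1,\dots,E_n\}$ be a local orthonormal frame of $D$ with $E_1=X$. Define $\widehat{\mathrm{Ric}}^D(X)=\sum_{j=2}^n\widehat R^D(X,E_j,E_j,X)$; $A^D(X)=\sum_{j=2}^n g(B(E_j,X),[E_j,X])$; $\|B^X\|^2=\sum_{j=2}^n[g(B(X,E_j),B(X,E_j))+g(B(E_j,X),B(E_j,X))]$; $H=\frac1n\sum_{i=1}^nB(E_i,E_i)$; $\alpha_1(X,Y)=(\nabla_X\omega)(Y)-\omega(X)\omega(Y)$; $\lambda_1=\sum_{j=1}^n\alpha_1(E_j,E_j)$. *)

(* Defs.v *)
From HB Require Import structures.
From mathcomp Require Import all_boot all_order all_algebra.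
From mathcomp Require Import all_classical all_reals all_analysis.
Set Implicit Arguments.
Unset Strict Implicit.
Unset Printing Implicit Defensive.
Import Order.TTheory GRing.Theory Num.Theory.
Import numFieldNormedType.Exports.
Local Open Scope classical_set_scope.
Local Open Scope ring_scope.

(* C^k on an open subset O of R^m, by iterated partial derivatives. *)
Fixpoint Ck_on (R : realType) (m k : nat) (O : set 'rV[R]_m)
    (f : 'rV[R]_m -> R) : Prop :=
  (forall x, O x -> {for x, continuous f}) /\
  if k is k'.+1 then
    forall i : 'I_m, (forall x, O x -> derivable f x (delta_mx 0 i)) /\
      Ck_on k' O (fun x => 'D_(delta_mx 0 i) f x)
  else True.

Definition Coo_on (R : realType) (m : nat) (O : set 'rV[R]_m)
  (f : 'rV[R]_m -> R) : Prop := forall k, Ck_on k O f.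

(* The values of [cmap] off [cdom], and of [cinv] off the image of [cdom], are
   irrelevant. *)
Record chart (R : realType) (m : nat) (M : topologicalType) := Chart {
  cdom : set M;
  cmap : M -> 'rV[R]_m;
  cinv : 'rV[R]_m -> M;
  cdom_open : open cdom;
  cimg_open : open (cmap @` cdom);
  cmapK : forall p, cdom p -> cinv (cmap p) = p;
  cmap_cont : {within cdom, continuous cmap};
  cinv_cont : {within cmap @` cdom, continuous cinv} }.

Definition transition_smooth (R : realType) (m : nat) (M : topologicalType)
    (a b : chart R m M) : Prop :=
  forall i : 'I_m, Coo_on (cmap a @` (cdom a `&` cdom b))
                          (fun x => cmap b (cinv a x) 0 i).

Record smoothManifold (R : realType) (m : nat) := SmoothManifold {
  carrier :> topologicalType;
  atlas : set (chart R m carrier);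
  manifold_hausdorff : hausdorff_space carrier;
  manifold_countable : @second_countable carrier;
  atlas_cover : forall p : carrier, exists2 a, atlas a & cdom a p;
  atlas_compat : forall a b, atlas a -> atlas b -> transition_smooth a b }.

Section Manifold.
Context {R : realType} {m : nat} {M : smoothManifold R m}.

Definition smooth_on (O : set M) (f : M -> R) : Prop :=
  forall a, atlas a -> Coo_on (cmap a @` (cdom a `&` O)) (f \o cinv a).

Definition smooth_near (p : M) (f : M -> R) : Prop :=
  exists O : set M, [/\ open O, O p & smooth_on O f].

(* T_p M is the space of derivations at p of the germs of smooth functions.  It
   is realised inside the vector space of all maps (M -> R) -> R; the value 0 on
   functions that are not smooth near p makes the representation unique. *)
Definition vect : Type := (M -> R) -> R^o.

Definition tangent (p : M) : set vect := [set v | [/\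
  forall f h : M -> R, smooth_near p f -> (\forall q \near p, f q = h q) ->
    v f = v h,
  forall (a : R) (f h : M -> R), smooth_near p f -> smooth_near p h ->
    v (fun q => a * f q + h q) = a * v f + v h,
  forall f h : M -> R, smooth_near p f -> smooth_near p h ->
    v (fun q => f q * h q) = v f * h p + f p * v h &
  forall f : M -> R, ~ smooth_near p f -> v f = 0]].

Definition vfield : Type := M -> (M -> R) -> R^o.

Definition smooth_vfield (O : set M) (X : vfield) : Prop :=
  (forall q, O q -> tangent q (X q)) /\
  (forall (W : set M) (f : M -> R), open W -> smooth_on W f ->
     smooth_on (O `&` W) (fun q => X q f)).

Definition lie (X Y : vfield) : vfield := fun p f =>
  if `[< smooth_near p f >]
  then X p (fun q => Y q f) - Y p (fun q => X q f) else 0.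

(* Only the values of g p on T_p M are meaningful. *)
Record riemannian_metric (g : M -> vect -> vect -> R) : Prop := {
  metric_sym : forall p u v, tangent p u -> tangent p v -> g p u v = g p v u;
  metric_lin : forall p (a : R) u v w,
    tangent p u -> tangent p v -> tangent p w ->
    g p (a *: u + v) w = a * g p u w + g p v w;
  metric_pos : forall p u, tangent p u -> u != 0 -> 0 < g p u u;
  metric_smooth : forall (O : set M) (X Y : vfield), open O ->
    smooth_vfield O X -> smooth_vfield O Y ->
    smooth_on O (fun q => g q (X q) (Y q)) }.

(* A connection acts on local vector fields: a vector field on an open set O is
   a total map that is smooth on O, and the connection is a local operator. *)
Record connection (nabla : vfield -> vfield -> vfield) : Prop := {
  conn_smooth : forall (O : set M) (X Y : vfield), open O ->
    smooth_vfield O X -> smooth_vfield O Y -> smooth_vfield O (nabla X Y);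
  conn_local : forall (O : set M) (X X' Y Y' : vfield), open O ->
    smooth_vfield O X -> smooth_vfield O Y ->
    (forall q, O q -> X q = X' q) -> (forall q, O q -> Y q = Y' q) ->
    forall p, O p -> nabla X Y p = nabla X' Y' p;
  conn_linl : forall (O : set M) (f : M -> R) (X X' Y : vfield), open O ->
    smooth_on O f ->
    smooth_vfield O X -> smooth_vfield O X' -> smooth_vfield O Y ->
    forall p, O p ->
    nabla (fun q => f q *: X q + X' q) Y p = f p *: nabla X Y p + nabla X' Y p;
  conn_addr : forall (O : set M) (X Y Y' : vfield), open O ->
    smooth_vfield O X -> smooth_vfield O Y -> smooth_vfield O Y' ->
    forall p, O p ->
    nabla X (fun q => Y q + Y' q) p = nabla X Y p + nabla X Y' p;
  conn_leibniz : forall (O : set M) (f : M -> R) (X Y : vfield), open O ->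
    smooth_on O f -> smooth_vfield O X -> smooth_vfield O Y ->
    forall p, O p ->
    nabla X (fun q => f q *: Y q) p = X p f *: Y p + f p *: nabla X Y p }.

Record levi_civita (g : M -> vect -> vect -> R)
    (nabla : vfield -> vfield -> vfield) : Prop := {
  lc_connection : connection nabla;
  lc_torsion_free : forall (O : set M) (X Y : vfield), open O ->
    smooth_vfield O X -> smooth_vfield O Y ->
    forall p, O p -> nabla X Y p - nabla Y X p = lie X Y p;
  lc_metric : forall (O : set M) (X Y Z : vfield), open O ->
    smooth_vfield O X -> smooth_vfield O Y -> smooth_vfield O Z ->
    forall p, O p ->
    X p (fun q => g q (Y q) (Z q)) =
      g p (nabla X Y p) (Z p) + g p (Y p) (nabla X Z p) }.

Definition curvature (nabla : vfield -> vfield -> vfield)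
    (X Y Z : vfield) : vfield := fun p =>
  nabla X (nabla Y Z) p - nabla Y (nabla X Z) p - nabla (lie X Y) Z p.

(* Sectional curvature of the plane spanned by X p and Y p. *)
Definition sectional_curvature (g : M -> vect -> vect -> R)
    (nabla : vfield -> vfield -> vfield) (X Y : vfield) (p : M) : R :=
  g p (curvature nabla X Y Y p) (X p) /
  (g p (X p) (X p) * g p (Y p) (Y p) - g p (X p) (Y p) ^+ 2).

Definition constant_sectional_curvature (g : M -> vect -> vect -> R)
    (nabla : vfield -> vfield -> vfield) (c : R) : Prop :=
  forall (O : set M) (X Y : vfield), open O ->
    smooth_vfield O X -> smooth_vfield O Y -> forall p, O p ->
    (forall a b : R, a *: X p + b *: Y p = 0 -> a = 0 /\ b = 0) ->
    sectional_curvature g nabla X Y p = c.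

Definition is_section (D : M -> set vect) (O : set M) (X : vfield) : Prop :=
  smooth_vfield O X /\ forall q, O q -> D q (X q).

Definition local_frame (n : nat) (D : M -> set vect) (O : set M)
    (E : 'I_n -> vfield) : Prop :=
  (forall i, is_section D O (E i)) /\
  (forall q, O q ->
    (forall a : 'I_n -> R, \sum_(i < n) a i *: E i q = 0 ->
       forall i, a i = 0) /\
    (forall v, D q v <-> exists a : 'I_n -> R, v = \sum_(i < n) a i *: E i q)).

(* Smooth subbundle of TM of constant rank n. *)
Definition subbundle (n : nat) (D : M -> set vect) : Prop :=
  forall p, exists (O : set M) (E : 'I_n -> vfield),
    [/\ open O, O p & local_frame D O E].

Definition non_integrable (D : M -> set vect) : Prop :=
  exists X Y : vfield, [/\ is_section D setT X, is_section D setT Y &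
    ~ is_section D setT (lie X Y)].

Definition orthonormal_frame (n : nat) (g : M -> vect -> vect -> R)
    (D : M -> set vect) (O : set M) (E : 'I_n -> vfield) : Prop :=
  local_frame D O E /\
  (forall q, O q -> forall i j, g q (E i q) (E j q) = (i == j)%:R).

Section Distribution.
Variables (g : M -> vect -> vect -> R) (nabla : vfield -> vfield -> vfield)
          (D : M -> set vect) (U : vfield).

Definition orth : M -> set vect := fun p =>
  [set v | tangent p v /\ forall w, D p w -> g p v w = 0].

(* For a finite-dimensional subspace S p of T_p M, the orthogonal projection
   onto it. *)
Definition orth_proj (S : M -> set vect) (p : M) (v : vect) : vect :=
  xget 0 [set w | S p w /\ forall z, S p z -> g p (v - w) z = 0].

Definition piD (X : vfield) : vfield := fun p => orth_proj D p (X p).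

Definition piDperp (X : vfield) : vfield := fun p => orth_proj orth p (X p).

Definition sff (X Y : vfield) : vfield := piDperp (nabla X Y).

Definition omega (p : M) (v : vect) : R := g p (U p) v.

Definition hnabla (X Y : vfield) : vfield := fun p =>
  nabla X Y p + omega p (Y p) *: X p.

Definition hnablaD (X Y : vfield) : vfield := piD (hnabla X Y).

Definition hRD (X Y Z : vfield) : vfield := fun p =>
  hnablaD X (hnablaD Y Z) p - hnablaD Y (hnablaD X Z) p
  - hnablaD (piD (lie X Y)) Z p - piD (lie (piDperp (lie X Y)) Z) p.

Definition hRD4 (X Y Z W : vfield) (p : M) : R := g p (hRD X Y Z p) (W p).

Definition nabla_omega (X Y : vfield) (p : M) : R :=
  X p (fun q => omega q (Y q)) - omega p (nabla X Y p).

Definition alpha1 (X Y : vfield) (p : M) : R :=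
  nabla_omega X Y p - omega p (X p) * omega p (Y p).

(* Frames are indexed by 'I_n, so that E_1 is the field of index 0 and the sums
   over j = 2, ..., n run over the indices 0 < j. *)
Section Frame.
Variables (n : nat) (E : 'I_n -> vfield) (X : vfield) (p : M).

Definition hRicD : R := \sum_(j < n | (0 < j)%N) hRD4 X (E j) (E j) X p.

Definition AD : R :=
  \sum_(j < n | (0 < j)%N) g p (sff (E j) X p) (lie (E j) X p).

Definition normBX2 : R :=
  \sum_(j < n | (0 < j)%N)
    (g p (sff X (E j) p) (sff X (E j) p)
     + g p (sff (E j) X p) (sff (E j) X p)).

Definition meanH : vect := (n%:R^-1 : R) *: \sum_(i < n) sff (E i) (E i) p.

Definition lambda1 : R := \sum_(j < n) alpha1 (E j) (E j) p.
End Frame.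
End Distribution.
End Manifold.

Arguments vect {R m} M.
Arguments vfield {R m} M.

(* Main.v *)
Require Import Defs.
From mathcomp Require Import all_boot all_order all_algebra.
From mathcomp Require Import all_classical all_reals all_analysis.
From mathcomp Require Import ring lra.
Import Order.TTheory GRing.Theory Num.Theory.
Import numFieldNormedType.Exports.
Local Open Scope classical_set_scope.
Local Open Scope ring_scope.
Set Implicit Arguments.
Unset Strict Implicit.
Unset Printing Implicit Defensive.

(** Write pi for the orthogonal projection onto [D], nabla^D = pi o nabla, and
[B] for the second fundamental form.  For sections of [D] the semi-symmetric
term only adds [omega Z *: X] to nabla^D_X Z, so expanding the curvature of the
modified connection gives the curvature of nabla^D plus terms in [alpha1] and in
[omega] of [B].  The curvature of nabla^D is compared with that of the
Levi-Civita connection by a Gauss equation.  A field V orthogonal to [D]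
satisfies g(nabla_X V, W) = - g(V, B(X, W)), which produces the quadratic terms
in [B].  Since [D] need not be integrable, the bracket term
pi [[X, Y]^perp, Z] adds the term - g([X, Y], B(Z, W)).  The outcome is
[hRD4_gauss]:

  hR(X, Y, Z, W) = R(X, Y, Z, W) + g(B(Y, Z), B(X, W)) - g(B(X, Z), B(Y, W))
    - g(B(Z, W), [X, Y]) + (alpha1(X, Z) + omega(B(X, Z))) g(Y, W)
    - (alpha1(Y, Z) + omega(B(Y, Z))) g(X, W).

Take W = X and Y = Z = E_j and sum over j >= 2.  The first term sums to
(n - 1) c, the last ones to the terms in [lambda1], [alpha1] and [omega], and the
fourth to the quantity [AD].  Two inequalities remain.  For each j,

  - g(B(X, E_j), B(E_j, X)) <= (|B(X, E_j)|^2 + |B(E_j, X)|^2) / 2,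

and, with T = n H, the sum of the g(B(E_j, E_j), B(X, X)) over j >= 2 is
g(T - B(X, X), B(X, X)) <= |T|^2 / 4, by expanding 0 <= |T - 2 B(X, X)|^2.

The operators involved are iterated, so every intermediate field has to be
smooth on the open set [O] of the frame; this is the role of the algebra of
smooth functions and fields.  Smoothness of projections is read off from the
formula pi(v) = sum_i g(v, E_i) E_i, and smoothness of Lie brackets from the
absence of torsion: [X, Y] = nabla_X Y - nabla_Y X. *)

(** * Functions of class C^k on open sets of R^m *)

Section CkAlgebra.
Context {R : realType} {m : nat}.
Implicit Types (k : nat) (O : set 'rV[R]_m) (f h : 'rV[R]_m -> R).

Lemma near_open (T : topologicalType) (A : set T) (P : T -> Prop) x :
  open A -> A x -> (forall y, A y -> P y) -> \forall y \near x, P y.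
Proof.
by move=> oA Ax AP; apply: filterS AP _; apply: open_nbhs_nbhs.
Qed.

Lemma continuous_eq_open (T : topologicalType) (A : set T) (f h : T -> R) x :
  open A -> A x -> (forall y, A y -> f y = h y) ->
  {for x, continuous f} -> {for x, continuous h}.
Proof.
move=> oA Ax fh cf; rewrite /prop_for /continuous_at -(fh _ Ax).
apply: cvg_trans cf; apply: near_eq_cvg.
exact: near_open oA Ax _.
Qed.

Lemma Ck_on_sub k O (O' : set 'rV[R]_m) f :
  O' `<=` O -> Ck_on k O f -> Ck_on k O' f.
Proof.
move=> sO; elim: k f => [|k IH] f [cf df]; split=> //=.
- by move=> x /sO; apply: cf.
- by move=> x /sO; apply: cf.
- move=> i; have [dfi Cf] := df i; split; last exact: IH.
  by move=> x /sO; apply: dfi.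
Qed.

(** [Ck_on] looks at total functions, but continuity and derivatives at a point
of an open set depend only on the values on that set. *)
Lemma Ck_on_eq k O f h : open O -> (forall x, O x -> f x = h x) ->
  Ck_on k O f -> Ck_on k O h.
Proof.
move=> oO; elim: k f h => [|k IH] f h fh [cf df].
  by split=> // x Ox; apply: (continuous_eq_open oO Ox fh); apply: cf.
split.
  by move=> x Ox; apply: (continuous_eq_open oO Ox fh); apply: cf.
move=> i; have [dfi Cf] := df i; split.
  by move=> x Ox; apply: near_eq_derivable (dfi x Ox); apply: (near_open oO Ox).
apply: IH Cf => x Ox; by apply: near_eq_derive; apply: (near_open oO Ox).
Qed.

Lemma Ck_onW k O f : Ck_on k.+1 O f -> Ck_on k O f.
Proof.
elim: k f => [|k IH] f [cf df]; split=> // i; have [dfi Cf] := df i.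
by split => //; apply: IH.
Qed.

Lemma Ck_on_cst k O (a : R) : Ck_on k O (cst a).
Proof.
have cc (b : R) (x : 'rV[R]_m) : {for x, continuous (cst b : 'rV[R]_m -> R)}.
  exact: cst_continuous.
elim: k a => [|k IH] a; split=> // i; split.
  by move=> *; exact: derivable_cst.
rewrite (_ : (fun x => _) = cst 0); first exact: IH.
by apply/funext => x; rewrite derive_cst.
Qed.

Lemma Ck_onD k O f h : open O -> Ck_on k O f -> Ck_on k O h ->
  Ck_on k O (fun x => f x + h x).
Proof.
move=> oO; elim: k f h => [|k IH] f h [cf df] [ch dh].
  by split=> // x Ox; apply: continuousD; [exact: cf|exact: ch].
split; first by move=> x Ox; apply: continuousD; [exact: cf|exact: ch].
move=> i; have [dfi Cf] := df i; have [dhi Ch] := dh i; split.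
  by move=> x Ox; apply: derivableD; [exact: dfi|exact: dhi].
apply: Ck_on_eq (IH _ _ Cf Ch) => // x Ox.
by rewrite -deriveD//; [exact: dfi|exact: dhi].
Qed.

(** Leibniz' rule expresses the derivative of the product of two functions of
class C^(k+1) through products of a function and a derivative, both of class
C^k. *)
Lemma Ck_onM k O f h : open O -> Ck_on k O f -> Ck_on k O h ->
  Ck_on k O (fun x => f x * h x).
Proof.
move=> oO; elim: k f h => [|k IH] f h Cf0 Ch0;
    have [cf df] := Cf0; have [ch dh] := Ch0.
  by split=> // x Ox; apply: continuousM; [exact: cf|exact: ch].
split; first by move=> x Ox; apply: continuousM; [exact: cf|exact: ch].
move=> i; have [dfi Cf] := df i; have [dhi Ch] := dh i; split.
  by move=> x Ox; apply: derivableM; [exact: dfi|exact: dhi].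
apply: Ck_on_eq
  (Ck_onD oO (IH _ _ (Ck_onW Cf0) Ch) (IH _ _ (Ck_onW Ch0) Cf)) => //.
by move=> x Ox; rewrite -[LHS]deriveM//; [exact: dfi|exact: dhi].
Qed.
End CkAlgebra.

(** * Smooth functions, tangent vectors and vector fields *)

Section SmoothOn.
Context {R : realType} {m : nat} {M : smoothManifold R m}.
Implicit Types (O W : set M) (f h : M -> R) (X Y Z V : vfield M) (p q : M).

(** Smoothness on an open set of [M] is tested on its images under the charts;
the extensionality and Leibniz arguments above need these to be open. *)
Lemma open_chart_image (a : chart R m M) O :
  open O -> open (cmap a @` (cdom a `&` O)).
Proof.
move=> oO; have oI : open (cmap a @` cdom a) by exact: cimg_open.
have -> : cmap a @` (cdom a `&` O) = (cmap a @` cdom a) `&` (cinv a @^-1` O).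
  apply/seteqP; split=> x /=.
    by move=> [q [aq Oq] <-]; rewrite /= cmapK//; split => //; exists q.
  by move=> [[q aq <-]]; rewrite /= cmapK// => Oq; exists q.
rewrite openE => x [Ix Ox]; apply: filterI; first exact: open_nbhs_nbhs.
have := @cinv_cont _ _ _ a; rewrite continuous_open_subspace//.
move=> /(_ x (mem_set Ix)).
by apply; apply: open_nbhs_nbhs.
Qed.

Lemma smooth_on_sub O W f : W `<=` O -> smooth_on O f -> smooth_on W f.
Proof.
move=> sW sf a aa k; apply: Ck_on_sub (sf a aa k).
by move=> x [q [aq Wq] <-]; exists q => //; split => //; apply: sW.
Qed.

Lemma smooth_on_eq O f h : open O -> (forall q, O q -> f q = h q) ->
  smooth_on O f -> smooth_on O h.
Proof.
move=> oO fh sf a aa k; apply: Ck_on_eq (sf a aa k).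
  exact: open_chart_image.
by move=> x [q [aq Oq] <-] /=; rewrite cmapK//; apply: fh.
Qed.

Lemma smooth_on_cst O (a : R) : smooth_on O (fun=> a).
Proof. by move=> b _ k; apply: Ck_on_cst. Qed.

Lemma smooth_onD O f h : open O -> smooth_on O f -> smooth_on O h ->
  smooth_on O (fun q => f q + h q).
Proof.
move=> oO sf sh a aa k; apply: Ck_onD (sf a aa k) (sh a aa k).
exact: open_chart_image.
Qed.

Lemma smooth_onM O f h : open O -> smooth_on O f -> smooth_on O h ->
  smooth_on O (fun q => f q * h q).
Proof.
move=> oO sf sh a aa k; apply: Ck_onM (sf a aa k) (sh a aa k).
exact: open_chart_image.
Qed.

Lemma tangent0 p : tangent p (0 : vect M).
Proof. by split=> // *; rewrite ?mulr0 ?mul0r ?addr0. Qed.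

Lemma tangentZD p (a : R) (u v : vect M) :
  tangent p u -> tangent p v -> tangent p (a *: u + v).
Proof.
move=> [u1 u2 u3 u4] [v1 v2 v3 v4]; split.
- move=> f h sf fh; change (a * u f + v f = a * u h + v h).
  by rewrite (u1 _ _ sf fh) (v1 _ _ sf fh).
- move=> b f h sf sh; change (a * u (fun q => b * f q + h q) +
    v (fun q => b * f q + h q) = b * (a * u f + v f) + (a * u h + v h)).
  by rewrite u2// v2//; ring.
- move=> f h sf sh; change (a * u (fun q => f q * h q) +
    v (fun q => f q * h q) = (a * u f + v f) * h p + f p * (a * u h + v h)).
  by rewrite u3// v3//; ring.
- by move=> f sf; change (a * u f + v f = 0); rewrite u4// v4// mulr0 addr0.
Qed.

Lemma tangentZ p (a : R) (u : vect M) : tangent p u -> tangent p (a *: u).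
Proof.
by move=> tu; rewrite -[_ *: _]addr0; apply: tangentZD => //; apply: tangent0.
Qed.

Lemma tangentD p (u v : vect M) :
  tangent p u -> tangent p v -> tangent p (u + v).
Proof. by move=> tu tv; rewrite -[u]scale1r; apply: tangentZD. Qed.

Lemma tangentB p (u v : vect M) :
  tangent p u -> tangent p v -> tangent p (u - v).
Proof.
by move=> tu tv; apply: tangentD => //; rewrite -scaleN1r; apply: tangentZ.
Qed.

Lemma tangent_sum p (I : Type) (r : seq I) (P : pred I) (v : I -> vect M) :
  (forall i, tangent p (v i)) -> tangent p (\sum_(i <- r | P i) v i).
Proof.
by move=> tv; elim/big_rec: _ => [|i u _ tu]; [apply: tangent0|apply: tangentD].
Qed.

(** Near [p], [f] agrees with [f + f], so locality and additivity of the
derivation give v f = v f + v f. *)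
Lemma tangent_near0 p (v : vect M) O f : tangent p v -> open O -> O p ->
  (forall q, O q -> f q = 0) -> v f = 0.
Proof.
move=> [v1 v2 v3 v4] oO Op f0.
have sf : smooth_near p f.
  exists O; split=> //; apply: smooth_on_eq (smooth_on_cst O 0) => // q Oq.
  by rewrite f0.
have : v f = v (fun q => 1 * f q + f q).
  apply: v1 => //; apply: (near_open oO Op) => // q /f0 ->.
  by rewrite mulr0 addr0.
rewrite v2// mul1r => /eqP; rewrite -subr_eq subrr => /eqP; exact: esym.
Qed.

Lemma smooth_vfield_sub O W X :
  W `<=` O -> smooth_vfield O X -> smooth_vfield W X.
Proof.
move=> sW [tX sX]; split=> [q /sW|W' f oW' sf]; first exact: tX.
by apply: smooth_on_sub (sX _ _ oW' sf); apply: setSI.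
Qed.

Lemma smooth_vfield_eq O X Y : open O -> (forall q, O q -> X q = Y q) ->
  smooth_vfield O X -> smooth_vfield O Y.
Proof.
move=> oO XY [tX sX]; split=> [q Oq|W f oW sf]; first by rewrite -XY//; apply: tX.
apply: smooth_on_eq (sX _ _ oW sf); first exact: openI.
by move=> q [Oq _]; rewrite XY.
Qed.

Lemma smooth_vfield0 O : smooth_vfield O (fun=> 0 : vect M).
Proof.
split=> [q _|W f _ _]; first exact: tangent0.
exact: smooth_on_cst.
Qed.

Lemma smooth_vfieldZD O f X Y : open O -> smooth_on O f ->
  smooth_vfield O X -> smooth_vfield O Y ->
  smooth_vfield O (fun q => f q *: X q + Y q).
Proof.
move=> oO sf [tX sX] [tY sY]; split=> [q Oq|W h oW sh].
  by apply: tangentZD; [apply: tX|apply: tY].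
have oI : open (O `&` W) by apply: openI.
apply: (smooth_onD oI _ (sY _ _ oW sh)); apply: (smooth_onM oI _ (sX _ _ oW sh)).
exact: smooth_on_sub sf.
Qed.

Lemma smooth_vfieldZ O f X : open O -> smooth_on O f ->
  smooth_vfield O X -> smooth_vfield O (fun q => f q *: X q).
Proof.
move=> oO sf sX; move: (smooth_vfieldZD oO sf sX (smooth_vfield0 O)).
apply: smooth_vfield_eq => //.
by move=> q _; rewrite addr0.
Qed.

Lemma smooth_vfieldD O X Y : open O -> smooth_vfield O X -> smooth_vfield O Y ->
  smooth_vfield O (fun q => X q + Y q).
Proof.
move=> oO sX sY.
apply: smooth_vfield_eq (smooth_vfieldZD oO (smooth_on_cst O 1) sX sY) => //.
by move=> q _; rewrite scale1r.
Qed.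

Lemma smooth_vfieldB O X Y : open O -> smooth_vfield O X -> smooth_vfield O Y ->
  smooth_vfield O (fun q => X q - Y q).
Proof.
move=> oO sX sY.
apply: smooth_vfield_eq (smooth_vfieldZD oO (smooth_on_cst O (-1)) sY sX) => //.
by move=> q _; rewrite scaleN1r addrC.
Qed.

Lemma smooth_vfield_sum O (I : Type) (r : seq I) (F : I -> vfield M) : open O ->
  (forall i, smooth_vfield O (F i)) ->
  smooth_vfield O (fun q => \sum_(i <- r) F i q).
Proof.
move=> oO sF; elim: r => [|i r IH].
  apply: smooth_vfield_eq (smooth_vfield0 O) => // q _.
  by rewrite big_nil.
apply: smooth_vfield_eq (smooth_vfieldD oO (sF i) IH) => // q _.
by rewrite big_cons.
Qed.
End SmoothOn.

(** * The metric on tangent vectors *)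

Section Metric.
Context {R : realType} {m : nat} {M : smoothManifold R m}.
Context {g : M -> vect M -> vect M -> R} (hg : riemannian_metric g).
Implicit Types (p q : M) (u v w : vect M).

Lemma metric0l p w : tangent p w -> g p 0 w = 0.
Proof.
move=> tw; have t0 := tangent0 p.
have := metric_lin hg 1 t0 t0 tw.
by rewrite scale1r addr0 mul1r => /eqP; rewrite -subr_eq subrr => /eqP <-.
Qed.

Lemma metricDl p u v w : tangent p u -> tangent p v -> tangent p w ->
  g p (u + v) w = g p u w + g p v w.
Proof.
by move=> tu tv tw; rewrite -{1}[u]scale1r (metric_lin hg)// mul1r.
Qed.

Lemma metricZl p (a : R) u w : tangent p u -> tangent p w ->
  g p (a *: u) w = a * g p u w.
Proof.
move=> tu tw; rewrite -[a *: u]addr0 (metric_lin hg)//; last exact: tangent0.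
by rewrite metric0l// addr0.
Qed.

Lemma metricBl p u v w : tangent p u -> tangent p v -> tangent p w ->
  g p (u - v) w = g p u w - g p v w.
Proof.
move=> tu tv tw; rewrite -scaleN1r metricDl ?metricZl//; last exact: tangentZ.
by rewrite mulN1r.
Qed.

Lemma metric_suml p (I : Type) (r : seq I) (P : pred I) (v : I -> vect M) w :
  (forall i, tangent p (v i)) -> tangent p w ->
  g p (\sum_(i <- r | P i) v i) w = \sum_(i <- r | P i) g p (v i) w.
Proof.
move=> tv tw; elim: r => [|i r IH]; first by rewrite !big_nil metric0l.
rewrite !big_cons; case: (P i) => //.
by rewrite metricDl// ?IH//; apply: tangent_sum.
Qed.

Lemma metricDr p u v w : tangent p u -> tangent p v -> tangent p w ->
  g p w (u + v) = g p w u + g p w v.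
Proof.
move=> tu tv tw; rewrite (Defs.metric_sym hg)// ?metricDl//; last exact: tangentD.
by congr (_ + _); apply: Defs.metric_sym.
Qed.

Lemma metricZr p (a : R) u w : tangent p u -> tangent p w ->
  g p w (a *: u) = a * g p w u.
Proof.
move=> tu tw; rewrite (Defs.metric_sym hg)// ?metricZl//; last exact: tangentZ.
by congr (_ * _); apply: Defs.metric_sym.
Qed.

Lemma metricBr p u v w : tangent p u -> tangent p v -> tangent p w ->
  g p w (u - v) = g p w u - g p w v.
Proof.
move=> tu tv tw; rewrite (Defs.metric_sym hg)// ?metricBl//; last exact: tangentB.
by congr (_ - _); apply: Defs.metric_sym.
Qed.

Lemma metric_sumr p (I : Type) (r : seq I) (P : pred I) (v : I -> vect M) w :
  (forall i, tangent p (v i)) -> tangent p w ->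
  g p w (\sum_(i <- r | P i) v i) = \sum_(i <- r | P i) g p w (v i).
Proof.
move=> tv tw; rewrite (Defs.metric_sym hg) ?metric_suml//; last exact: tangent_sum.
by apply: eq_bigr => i _; apply: Defs.metric_sym.
Qed.

Lemma metric_ge0 p u : tangent p u -> 0 <= g p u u.
Proof.
move=> tu; have [->|u0] := eqVneq u 0; last exact/ltW/(metric_pos hg).
by rewrite metric0l//; apply: tangent0.
Qed.

Lemma metric_definite p u : tangent p u -> g p u u = 0 -> u = 0.
Proof.
move=> tu u0; apply/eqP; apply: contraT => /(metric_pos hg tu).
by rewrite u0 ltxx.
Qed.

(** This is 0 <= |u - v|^2. *)
Lemma metric_mul_le p u v : tangent p u -> tangent p v ->
  g p u v <= (g p u u + g p v v) / 2.
Proof.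
move=> tu tv; have := metric_ge0 (tangentB tu tv).
rewrite metricBl ?metricBr//; try exact: tangentB.
rewrite (Defs.metric_sym hg tv tu); lra.
Qed.

(** This is 0 <= |u - 2 v|^2; it bounds the trace terms of the Gauss equation by
the squared mean curvature. *)
Lemma metric_split_le p u v : tangent p u -> tangent p v ->
  g p (u - v) v <= g p u u / 4.
Proof.
move=> tu tv; rewrite metricBl//.
have tw : tangent p (u - (2 : R) *: v) by apply: tangentB => //; apply: tangentZ.
have := metric_ge0 tw.
rewrite metricBl ?metricBr ?metricZr ?metricZl//.
all: try exact: tangentZ; try exact: tangentB.
rewrite (Defs.metric_sym hg tv tu); lra.
Qed.
End Metric.

(** * Orthogonal projections in an orthonormal frame *)

Section FrameProjection.
Context {R : realType} {m n : nat} {M : smoothManifold R m}.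
Context {g : M -> vect M -> vect M -> R} (hg : riemannian_metric g).
Context {D : M -> set (vect M)} {O : set M} {E : 'I_n -> vfield M}.
Hypotheses (hO : open O) (hE : orthonormal_frame g D O E).
Implicit Types (p q : M) (u v w : vect M) (X Y : vfield M).

Lemma smooth_frame i : smooth_vfield O (E i).
Proof. by have [[sE _] _] := hE; have [] := sE i. Qed.

Lemma tangent_frame q i : O q -> tangent q (E i q).
Proof. by move=> Oq; have [tE _] := smooth_frame i; apply: tE. Qed.

Lemma frame_in q i : O q -> D q (E i q).
Proof. by move=> Oq; have [[sE _] _] := hE; have [_ ] := sE i; apply. Qed.

Definition frame_proj q v : vect M := \sum_(i < n) g q v (E i q) *: E i q.

Lemma tangent_frame_comb q (a : 'I_n -> R) :
  O q -> tangent q (\sum_(i < n) a i *: E i q).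
Proof.
by move=> Oq; apply: tangent_sum => i; apply: tangentZ; apply: tangent_frame.
Qed.

Lemma metric_frame_comb q (a : 'I_n -> R) j :
  O q -> g q (\sum_(i < n) a i *: E i q) (E j q) = a j.
Proof.
move=> Oq; have [_ oE] := hE; rewrite (metric_suml hg); last 2 first.
- by move=> i; apply: tangentZ; apply: tangent_frame.
- exact: tangent_frame.
rewrite (bigD1 j)//= big1 => [|i ij].
  by rewrite (metricZl hg) ?oE ?eqxx ?mulr1 ?addr0//; apply: tangent_frame.
by rewrite (metricZl hg) ?oE ?(negbTE ij) ?mulr0//; apply: tangent_frame.
Qed.

Lemma frame_comb_in q (a : 'I_n -> R) : O q -> D q (\sum_(i < n) a i *: E i q).
Proof.
by move=> Oq; have [[_ fE] _] := hE; have [_ sp] := fE _ Oq; apply/sp; exists a.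
Qed.

Lemma frame_proj_id q v : O q -> D q v -> frame_proj q v = v.
Proof.
move=> Oq Dv; have [[_ fE] _] := hE; have [_ /(_ v) sp] := fE _ Oq.
have [a ->] := sp.1 Dv; apply: eq_bigr => i _.
by rewrite metric_frame_comb.
Qed.

Lemma tangent_distribution q v : O q -> D q v -> tangent q v.
Proof.
by move=> Oq Dv; rewrite -(frame_proj_id Oq Dv); apply: tangent_frame_comb.
Qed.

Lemma metric_frame_proj q v w :
  O q -> tangent q v -> D q w -> g q (frame_proj q v) w = g q v w.
Proof.
move=> Oq tv Dw; rewrite -(frame_proj_id Oq Dw) !(metric_sumr hg)//.
- apply: eq_bigr => i _.
  rewrite !(metricZr hg) ?metric_frame_comb//; try exact: tangent_frame.
  exact: tangent_frame_comb.
- by move=> i; apply: tangentZ; apply: tangent_frame.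
- by move=> i; apply: tangentZ; apply: tangent_frame.
- exact: tangent_frame_comb.
Qed.

(** A projection [w] of [v] lies in [D], so it is the combination of the frame
with coefficients g(w, E_i), and these equal g(v, E_i).  Hence the choice made in
[orth_proj] is forced. *)
Lemma orth_proj_frame q v : O q -> tangent q v ->
  orth_proj g D q v = frame_proj q v.
Proof.
move=> Oq tv; have tp : tangent q (frame_proj q v) by exact: tangent_frame_comb.
apply: xget_unique.
  split=> [|z Dz]; first exact: frame_comb_in.
  have tz := tangent_distribution Oq Dz.
  by rewrite (metricBl hg)// metric_frame_proj// subrr.
move=> w [Dw ow]; rewrite -(frame_proj_id Oq Dw); apply: eq_bigr => i _.
have tw := tangent_distribution Oq Dw; have ti := tangent_frame i Oq.
congr (_ *: _); apply/esym/eqP; rewrite -subr_eq0 -(metricBl hg)//; apply/eqP/ow.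
exact: frame_in.
Qed.

(** Two projections of [v] onto the orthogonal complement differ by an element
[d] of the complement with g(d, d) = 0. *)
Lemma orth_proj_perp_frame q v : O q -> tangent q v ->
  orth_proj g (orth g D) q v = v - frame_proj q v.
Proof.
move=> Oq tv; have tp : tangent q (frame_proj q v) by exact: tangent_frame_comb.
have tB := tangentB tv tp.
have oB : orth g D q (v - frame_proj q v).
  split=> // w Dw; have tw := tangent_distribution Oq Dw.
  by rewrite (metricBl hg)// metric_frame_proj// subrr.
have oBz z : orth g D q z -> g q (v - (v - frame_proj q v)) z = 0.
  move=> [tz oz]; rewrite subKr (Defs.metric_sym hg)//; apply: oz.
  exact: frame_comb_in.
apply: xget_unique; first by split.
move=> /= w [[tw ow] pw]; apply/eqP; rewrite -subr_eq0; apply/eqP.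
set w0 := v - frame_proj q v; have td := tangentB tw tB.
have od : orth g D q (w - w0).
  split=> // z Dz; have tz := tangent_distribution Oq Dz.
  by rewrite (metricBl hg)// ow// (oB.2 z Dz) subrr.
apply: (metric_definite hg td).
have dE (V : zmodType) (a b d : V) : a - d = (b - d) - (b - a).
  by rewrite opprD opprK addrACA subrr add0r addrC.
rewrite {1}(dE _ w v w0) (metricBl hg (tangentB tv tB) (tangentB tv tw))//.
by rewrite (oBz _ od) (pw _ od) subrr.
Qed.

Lemma piD_in X q : O q -> tangent q (X q) -> D q (piD g D X q).
Proof. by move=> Oq tX; rewrite /piD orth_proj_frame//; apply: frame_comb_in. Qed.

Lemma metric_piD X q w : O q -> tangent q (X q) -> D q w ->
  g q (piD g D X q) w = g q (X q) w.
Proof. by move=> Oq tX Dw; rewrite /piD orth_proj_frame// metric_frame_proj. Qed.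

Lemma piD_piDperp X q : O q -> tangent q (X q) ->
  piD g D X q + piDperp g D X q = X q.
Proof.
move=> Oq tX; rewrite /piD /piDperp orth_proj_frame//.
by rewrite orth_proj_perp_frame// addrC subrK.
Qed.

Lemma smooth_piD X : smooth_vfield O X -> smooth_vfield O (piD g D X).
Proof.
move=> sX; apply: (smooth_vfield_eq hO (X := fun q => frame_proj q (X q))).
  by move=> q Oq; rewrite /piD orth_proj_frame//; apply: sX.1.
apply: smooth_vfield_sum => // i; apply: smooth_vfieldZ => //.
  by apply: (metric_smooth hg) => //; apply: smooth_frame.
exact: smooth_frame.
Qed.

Lemma smooth_piDperp X : smooth_vfield O X -> smooth_vfield O (piDperp g D X).
Proof.
move=> sX; have := smooth_vfieldB hO sX (smooth_piD sX).
apply: smooth_vfield_eq => // q Oq.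
by rewrite -{1}(piD_piDperp Oq (sX.1 _ Oq)) addrAC subrr add0r.
Qed.

Lemma metric_piDperp X q w : O q -> tangent q (X q) -> D q w ->
  g q (piDperp g D X q) w = 0.
Proof.
move=> Oq tX Dw; rewrite /piDperp orth_proj_perp_frame//.
have tw := tangent_distribution Oq Dw.
by rewrite (metricBl hg) ?metric_frame_proj ?subrr//; apply: tangent_frame_comb.
Qed.
End FrameProjection.

(** * The Gauss equation of the projected connection *)

Section Gauss.
Context {R : realType} {m n : nat} {M : smoothManifold R m}.
Context {g : M -> vect M -> vect M -> R} (hg : riemannian_metric g).
Context {nabla : vfield M -> vfield M -> vfield M} (hnab : levi_civita g nabla).
Context {D : M -> set (vect M)} {O : set M} {E : 'I_n -> vfield M}.
Hypotheses (hO : open O) (hE : orthonormal_frame g D O E).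
Context {U : vfield M} (hU : smooth_vfield O U).
Implicit Types (p q : M) (u v w : vect M) (X Y Z W V : vfield M).

Let hC := lc_connection hnab.
Let sO X Y := conn_smooth hC (X := X) (Y := Y) hO.

(** Absence of torsion writes the bracket as nabla_X Y - nabla_Y X. *)
Lemma smooth_lie X Y : smooth_vfield O X -> smooth_vfield O Y ->
  smooth_vfield O (lie X Y).
Proof.
move=> sX sY; move: (smooth_vfieldB hO (sO sX sY) (sO sY sX)).
apply: smooth_vfield_eq => //.
exact: (lc_torsion_free hnab hO).
Qed.

Lemma smooth_sff X Y : smooth_vfield O X -> smooth_vfield O Y ->
  smooth_vfield O (sff g nabla D X Y).
Proof. by move=> sX sY; apply: (smooth_piDperp hg hO hE); apply: sO. Qed.

Lemma metric_sff X Y q w : smooth_vfield O X -> smooth_vfield O Y ->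
  O q -> D q w -> g q (sff g nabla D X Y q) w = 0.
Proof.
by move=> sX sY Oq Dw; apply: (metric_piDperp hg hE) => //; apply: (sO sX sY).1.
Qed.

Lemma metric_perp_sff V X W q : smooth_vfield O V ->
  smooth_vfield O X -> smooth_vfield O W -> O q ->
  (forall w, D q w -> g q (V q) w = 0) ->
  g q (V q) (nabla X W q) = g q (V q) (sff g nabla D X W q).
Proof.
move=> sV sX sW Oq pV; have sXW := sO sX sW.
rewrite -{1}(piD_piDperp hg hE Oq (sXW.1 q Oq)) (metricDr hg).
- by rewrite pV ?add0r//; apply: (piD_in hg hE) => //; apply: sXW.1.
- exact: (smooth_piD hg hO hE sXW).1.
- exact: (smooth_piDperp hg hO hE sXW).1.
- exact: sV.1.
Qed.

(** The Weingarten relation: differentiate g(V, W) = 0 in the direction [X]. *)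
Lemma metric_nabla_perp V X W p : smooth_vfield O V -> smooth_vfield O X ->
  is_section D O W -> O p ->
  (forall q w, O q -> D q w -> g q (V q) w = 0) ->
  g p (nabla X V p) (W p) = - g p (V p) (sff g nabla D X W p).
Proof.
move=> sV sX [sW DW] Op pV.
have := lc_metric hnab hO sX sV sW Op.
rewrite (tangent_near0 (sX.1 p Op) hO Op); last first.
  by move=> q Oq; apply: pV => //; apply: DW.
rewrite (metric_perp_sff sV sX sW Op)//; last by move=> w; apply: pV.
by move=> /eqP; rewrite eq_sym addr_eq0 => /eqP.
Qed.

Lemma metric_hnablaD X V p w : smooth_vfield O X -> smooth_vfield O V ->
  O p -> D p w ->
  g p (hnablaD g nabla D U X V p) w =
    g p (nabla X V p) w + omega g U p (V p) * g p (X p) w.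
Proof.
move=> sX sV Op Dw; have tw := tangent_distribution hg hE Op Dw.
have tX := sX.1 p Op; have tN := (sO sX sV).1 p Op.
rewrite (metric_piD hg hE)//.
  by rewrite (metricDl hg)// ?(metricZl hg)//; apply: tangentZ.
by apply: tangentD => //; apply: tangentZ.
Qed.

Lemma smooth_omega Y :
  smooth_vfield O Y -> smooth_on O (fun q => omega g U q (Y q)).
Proof. by move=> sY; apply: (metric_smooth hg). Qed.

Lemma smooth_hnablaD X V : smooth_vfield O X -> smooth_vfield O V ->
  smooth_vfield O (hnablaD g nabla D U X V).
Proof.
move=> sX sV; apply: (smooth_piD hg hO hE); apply: smooth_vfieldD => //.
  exact: sO.
by apply: smooth_vfieldZ => //; apply: smooth_omega.
Qed.

(** The decomposition of nabla_Y Z into its [D]-part and [B], written without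
subtraction so that a connection can be applied to both sides. *)
Lemma hnablaD_sff Y Z q : is_section D O Y -> smooth_vfield O Z -> O q ->
  hnablaD g nabla D U Y Z q + sff g nabla D Y Z q =
    omega g U q (Z q) *: Y q + nabla Y Z q.
Proof.
move=> [sY DY] sZ Oq; have tY := sY.1 q Oq; have tN := (sO sY sZ).1 q Oq.
have tH : tangent q (hnabla g nabla U Y Z q).
  by apply: tangentD => //; apply: tangentZ.
rewrite -{1}(piD_piDperp hg hE Oq tN) /hnablaD /sff addrA; congr (_ + _).
rewrite /piD !(orth_proj_frame hg hE)// -{1}(frame_proj_id hg hE Oq (DY q Oq)).
rewrite /frame_proj scaler_sumr -big_split/=; apply: eq_bigr => i _.
have ti := tangent_frame hE i Oq.
rewrite (metricDl hg) ?(metricZl hg)//; last exact: tangentZ.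
by rewrite addrC scalerDl scalerA.
Qed.

(** Apply nabla_X to [hnablaD_sff]; the Weingarten relation turns the term
nabla_X (B(Y, Z)) into g(B(Y, Z), B(X, W)). *)
Lemma nabla_hnablaD X Y Z W p : is_section D O X -> is_section D O Y ->
  is_section D O Z -> is_section D O W -> O p ->
  g p (nabla X (hnablaD g nabla D U Y Z) p) (W p) =
    g p (nabla X (nabla Y Z) p) (W p)
    + g p (sff g nabla D Y Z p) (sff g nabla D X W p)
    + g p (Y p) (W p) * X p (fun q => omega g U q (Z q))
    + omega g U p (Z p) * g p (nabla X Y p) (W p).
Proof.
move=> [sX DX] secY [sZ DZ] secW Op; have [sY DY] := secY; have [sW DW] := secW.
have sH := smooth_hnablaD sY sZ; have sB := smooth_sff sY sZ.
have sN := sO sY sZ; have swY := smooth_vfieldZ hO (smooth_omega sZ) sY.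
have e1 := conn_addr hC hO sX sH sB Op.
rewrite (conn_local hC hO sX (smooth_vfieldD hO sH sB) (fun _ _ => erefl)
  (fun q Oq => hnablaD_sff secY sZ Oq) Op) in e1.
rewrite (conn_addr hC hO sX swY sN Op) in e1.
rewrite (conn_leibniz hC hO (smooth_omega sZ) sX sY Op) in e1.
have tW := sW.1 p Op.
have /(congr1 (fun v => g p v (W p))) := e1.
have tXY := (sO sX sY).1 p Op.
have tY := sY.1 p Op.
have tXH := (sO sX sH).1 p Op.
have tXB := (sO sX sB).1 p Op.
have tXN := (sO sX sN).1 p Op.
rewrite !(metricDl hg)//; try exact: tangentZ.
all: try by apply: tangentD => //; apply: tangentZ.
rewrite !(metricZl hg)// (metric_nabla_perp sB sX secW)//; last first.
  by move=> q w Oq Dw; apply: metric_sff.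
set b := g p (sff g nabla D Y Z p) _ => h.
by rewrite -[LHS](addrNK b) -h; ring.
Qed.

(** The terms omega(Z) g(nabla_X Y - nabla_Y X, W) produced by
[nabla_hnablaD] cancel against the semi-symmetric part of the derivative along
[X, Y]^D.  In the last term of [hRD], absence of torsion gives
[V, Z] = nabla_V Z - nabla_Z V for V = [X, Y]^perp: the first summand completes
the derivative along [X, Y]^D to the derivative along [X, Y] that occurs in the
curvature, and the Weingarten relation applies to the second. *)
Lemma hRD4_gauss X Y Z W p : is_section D O X -> is_section D O Y ->
  is_section D O Z -> is_section D O W -> O p ->
  hRD4 g nabla D U X Y Z W p =
    g p (curvature nabla X Y Z p) (W p)
    + g p (sff g nabla D Y Z p) (sff g nabla D X W p)
    - g p (sff g nabla D X Z p) (sff g nabla D Y W p)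
    - g p (sff g nabla D Z W p) (lie X Y p)
    + (alpha1 g nabla U X Z p + omega g U p (sff g nabla D X Z p))
      * g p (Y p) (W p)
    - (alpha1 g nabla U Y Z p + omega g U p (sff g nabla D Y Z p))
      * g p (X p) (W p).
Proof.
move=> secX secY secZ secW Op.
have [sX DX] := secX; have [sY DY] := secY.
have [sZ DZ] := secZ; have [sW DW] := secW.
have [tX tY tZ tW] := And4 (sX.1 p Op) (sY.1 p Op) (sZ.1 p Op) (sW.1 p Op).
have tU := hU.1 p Op.
have sL := smooth_lie sX sY; have tL := sL.1 p Op.
have sLD := smooth_piD hg hO hE sL; have sLP := smooth_piDperp hg hO hE sL.
have [tLD tLP] := conj (sLD.1 p Op) (sLP.1 p Op).
have sHX := smooth_hnablaD sX sZ; have sHY := smooth_hnablaD sY sZ.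
have sK := smooth_lie sLP sZ.
have DWp := DW p Op.
have tB V V' : smooth_vfield O V -> smooth_vfield O V' ->
  tangent p (sff g nabla D V V' p).
  by move=> sV sV'; apply: (smooth_sff sV sV').1.
have tN V V' : smooth_vfield O V -> smooth_vfield O V' ->
  tangent p (nabla V V' p).
  by move=> sV sV'; apply: (sO sV sV').1.
rewrite /hRD4 /hRD !(metricBl hg)//.
all: try repeat apply: tangentB.
all: try by [exact: (smooth_hnablaD sX sHY).1 p Op
  |exact: (smooth_hnablaD sY sHX).1 p Op
  |exact: (smooth_hnablaD sLD sZ).1 p Op
  |exact: (smooth_piD hg hO hE sK).1 p Op
  |exact: tN|apply: tN => //; exact: sO].
rewrite !metric_hnablaD// (metric_piD hg hE Op tL DWp).
rewrite (metric_piD hg hE Op (sK.1 p Op) DWp).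
rewrite !nabla_hnablaD//.
(* The first summand of [V, Z] = nabla_V Z - nabla_Z V, for V = [X, Y]^perp, is
   kept for the curvature; the second one becomes g(V, B(Z, W)). *)
rewrite -(lc_torsion_free hnab hO sLP sZ Op) (metricBl hg)//; last 2 first.
- exact: (sO sLP sZ).1.
- exact: (sO sZ sLP).1.
rewrite (metric_nabla_perp sLP sZ secW Op); last first.
  by move=> q w Oq Dw; apply: (metric_piDperp hg hE) => //; apply: sL.1.
have LDP := piD_piDperp hg hE Op tL.
have -> : g p (piDperp g D (lie X Y) p) (sff g nabla D Z W p) =
          g p (sff g nabla D Z W p) (lie X Y p).
  rewrite -{1}LDP (metricDr hg)//; last exact: tB.
  rewrite metric_sff ?add0r//; last exact: (piD_in hg hE).
  by rewrite (Defs.metric_sym hg)//; apply: tB.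
have -> : g p (lie X Y p) (W p) =
          g p (nabla X Y p) (W p) - g p (nabla Y X p) (W p).
  rewrite -(lc_torsion_free hnab hO sX sY Op) (metricBl hg)//; exact: tN.
have nL : nabla (lie X Y) Z p =
  nabla (piD g D (lie X Y)) Z p + nabla (piDperp g D (lie X Y)) Z p.
  have := conn_linl hC hO (smooth_on_cst O 1) sLD sLP sZ Op; rewrite scale1r => <-.
  apply: (conn_local hC hO sL sZ) => // q Oq.
  by rewrite scale1r (piD_piDperp hg hE)//; apply: sL.1.
rewrite nL (metricDl hg (tN _ _ sLD sZ) (tN _ _ sLP sZ) tW).
(* Pairing [hnablaD_sff] with [U] trades omega of the projected derivative for
   omega of nabla, which [alpha1] contains, and omega of [B]. *)
have wH V : is_section D O V ->
  omega g U p (hnablaD g nabla D U V Z p) + omega g U p (sff g nabla D V Z p) =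
  omega g U p (Z p) * omega g U p (V p) + omega g U p (nabla V Z p).
  move=> secV; have [sV _] := secV.
  have /(congr1 (fun v => g p (U p) v)) := hnablaD_sff secV sZ Op.
  have tV := sV.1 p Op.
  rewrite !(metricDr hg) ?(metricZr hg)//.
  - exact: tangentZ.
  - exact: tN.
  - exact: (smooth_hnablaD sV sZ).1.
  - exact: tB.
(* The direct derivative comes second so that the sum is formed in [R], not in
   [R^o], and [ring] recognises it. *)
have aE V : alpha1 g nabla U V Z p =
  - omega g U p (nabla V Z p) + V p (fun q => omega g U q (Z q))
  - omega g U p (V p) * omega g U p (Z p).
  by congr (_ - _); exact: addrC.
rewrite !aE.
have wN V : is_section D O V -> omega g U p (hnablaD g nabla D U V Z p) =
  omega g U p (Z p) * omega g U p (V p) + omega g U p (nabla V Z p)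
  - omega g U p (sff g nabla D V Z p).
  by move=> secV; rewrite -wH// addrK.
rewrite !wN//; ring.
Qed.
End Gauss.

(** * The bound on the Ricci curvature *)

Lemma constant_curvature_orthonormal (R : realType) (m : nat) (M : smoothManifold R m)
    (g : M -> vect M -> vect M -> R) (nabla : vfield M -> vfield M -> vfield M)
    (c : R) (O : set M) (X Y : vfield M) p :
  riemannian_metric g -> constant_sectional_curvature g nabla c -> open O ->
  smooth_vfield O X -> smooth_vfield O Y -> O p ->
  g p (X p) (X p) = 1 -> g p (Y p) (Y p) = 1 -> g p (X p) (Y p) = 0 ->
  g p (curvature nabla X Y Y p) (X p) = c.
Proof.
move=> hg hc oO sX sY Op XX YY XY.
have [tX tY] := conj (sX.1 p Op) (sY.1 p Op).
have YX : g p (Y p) (X p) = 0 by rewrite (Defs.metric_sym hg).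
rewrite -(hc O X Y oO sX sY p Op).
  by rewrite /sectional_curvature XX YY XY expr0n mulr1 subr0 divr1.
move=> a b ab0.
have coef v : tangent p v -> a * g p (X p) v + b * g p (Y p) v = 0.
  move=> tv; have := metric0l hg tv.
  by rewrite -ab0 (metricDl hg) ?(metricZl hg)//; apply: tangentZ.
split.
  by have := coef _ tX; rewrite XX YX mulr1 mulr0 addr0.
by have := coef _ tY; rewrite XY YY mulr1 mulr0 add0r.
Qed.

Lemma alpha1_eq (R : realType) (m : nat) (M : smoothManifold R m)
    (g : M -> vect M -> vect M -> R) (nabla : vfield M -> vfield M -> vfield M)
    (U : vfield M) (O : set M) (X Y X' Y' : vfield M) p :
  riemannian_metric g -> connection nabla -> open O -> smooth_vfield O U ->
  smooth_vfield O X -> smooth_vfield O Y ->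
  (forall q, O q -> X q = X' q) -> (forall q, O q -> Y q = Y' q) -> O p ->
  alpha1 g nabla U X Y p = alpha1 g nabla U X' Y' p.
Proof.
move=> hg hC oO sU sX sY XX' YY' Op; have [tXp _ _ _] := sX.1 p Op.
rewrite /alpha1 /nabla_omega (conn_local hC oO sX sY XX' YY' Op).
rewrite -(XX' p Op) -(YY' p Op); congr (_ - _ - _).
apply: tXp.
  by exists O; split=> //; apply: (metric_smooth hg).
by apply: (near_open oO Op) => q Oq; rewrite YY'.
Qed.

Section RicciBound.
Context {R : realType} {m n : nat} {M : smoothManifold R m}.
Context {g : M -> vect M -> vect M -> R} (hg : riemannian_metric g).
Context {nabla : vfield M -> vfield M -> vfield M} (hnab : levi_civita g nabla).
Context {D : M -> set (vect M)} {O : set M} {E : 'I_n -> vfield M}.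
Hypotheses (hO : open O) (hE : orthonormal_frame g D O E).
Context {U : vfield M} (hU : smooth_vfield O U).
Context {c : R} (hc : constant_sectional_curvature g nabla c).

(** With Z = Y and W = X in the Gauss equation, g(X, Y) = 0 removes the terms in
alpha1(X, Y) and omega(B(X, Y)), and the mixed product of B(X, Y) and B(Y, X) is
bounded by the arithmetic mean of the squared norms. *)
Lemma hRD4_le X Y p : is_section D O X -> is_section D O Y -> O p ->
  g p (X p) (X p) = 1 -> g p (Y p) (Y p) = 1 -> g p (X p) (Y p) = 0 ->
  hRD4 g nabla D U X Y Y X p <=
    c + g p (sff g nabla D Y Y p) (sff g nabla D X X p)
    + (g p (sff g nabla D X Y p) (sff g nabla D X Y p)
       + g p (sff g nabla D Y X p) (sff g nabla D Y X p)) / 2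
    + g p (sff g nabla D Y X p) (lie Y X p)
    - (alpha1 g nabla U Y Y p + omega g U p (sff g nabla D Y Y p)).
Proof.
move=> secX secY Op XX YY XY; have [[sX _] [sY _]] := conj secX secY.
have tB V W : smooth_vfield O V -> smooth_vfield O W ->
  tangent p (sff g nabla D V W p).
  by move=> sV sW; apply: (smooth_sff hg hnab hO hE sV sW).1.
have tL := (smooth_lie hnab hO sY sX).1 p Op.
have YX : g p (Y p) (X p) = 0.
  by rewrite (Defs.metric_sym hg)//; [apply: sY.1|apply: sX.1].
rewrite (hRD4_gauss hg hnab hO hE hU secX secY secY secX Op).
rewrite (constant_curvature_orthonormal hg hc hO sX sY Op XX YY XY).
have -> : lie X Y p = (-1 : R) *: lie Y X p.
  rewrite -(lc_torsion_free hnab hO sX sY Op) -(lc_torsion_free hnab hO sY sX Op).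
  by rewrite scaleN1r opprB.
rewrite (metricZr hg)//; last exact: tB.
have tBN : tangent p ((-1 : R) *: sff g nabla D X Y p) by apply/tangentZ/tB.
have := metric_mul_le hg tBN (tB _ _ sY sX).
rewrite !(metricZl hg) ?(metricZr hg)//; try exact: tB.
rewrite XX YX; lra.
Qed.
End RicciBound.
Theorem theorem3p6 (R : realType) (m n : nat) (M : smoothManifold R m)
    (g : M -> vect M -> vect M -> R)
    (nabla : vfield M -> vfield M -> vfield M)
    (D : M -> set (vect M)) (U : vfield M) (c : R)
    (hn : (2 <= n)%N)
    (hg : riemannian_metric g)
    (hnabla : levi_civita g nabla)
    (hc : constant_sectional_curvature g nabla c)
    (hD : subbundle n D)
    (hDni : non_integrable D)
    (hU : smooth_vfield setT U)
    (X : vfield M)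
    (hX : is_section D setT X)
    (hX1 : forall q, g q (X q) (X q) = 1)
    (O : set M) (E : 'I_n -> vfield M)
    (hO : open O)
    (hE : orthonormal_frame g D O E)
    (hEX : forall i : 'I_n, nat_of_ord i = 0%N ->
             forall q, O q -> E i q = X q)
    (p : M) (hp : O p) :
  hRicD g nabla D U E X p <=
    (n%:R - 1) * c - lambda1 g nabla U E p + alpha1 g nabla U X X p
    - n%:R * omega g U p (meanH g nabla D E p)
    + omega g U p (sff g nabla D X X p)
    + n%:R ^+ 2 / 4
      * g p (meanH g nabla D E p) (meanH g nabla D E p)
    + normBX2 g nabla D E X p / 2
    + AD g nabla D E X p.
Proof.
have [[secE _] oE] := hE.
have sE i : smooth_vfield O (E i) by have [] := secE i.
have sU : smooth_vfield O U by apply: smooth_vfield_sub hU.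
have [sXT DX] := hX.
have sX : smooth_vfield O X by apply: smooth_vfield_sub sXT.
have secX : is_section D O X by split=> // q _; apply: DX.
have hC := lc_connection hnabla.
have n0 : (0 < n)%N by apply: ltnW.
pose i0 : 'I_n := Ordinal n0.
have E0 := hEX i0 erefl.
pose B V W := sff g nabla D V W p.
have tB V W : smooth_vfield O V -> smooth_vfield O W -> tangent p (B V W).
  by move=> sV sW; apply: (smooth_sff hg hnabla hO hE sV sW).1.
have split0 (F : 'I_n -> R) : \sum_i F i = F i0 + \sum_(i < n | (0 < i)%N) F i.
  by rewrite (bigD1 i0)//=; congr (_ + _); apply: eq_bigl => i; rewrite lt0n.
(* The first field of the frame coincides with [X] only on [O], so locality of the
   operators is needed to identify its contributions. *)
have B0 : B (E i0) (E i0) = B X X.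
  by rewrite /B /sff /piDperp (conn_local hC hO (sE i0) (sE i0) E0 E0 hp).
have a0 : alpha1 g nabla U (E i0) (E i0) p = alpha1 g nabla U X X p.
  exact: (alpha1_eq hg hC hO sU (sE i0) (sE i0) E0 E0 hp).
have EE j : g p (E j p) (E j p) = 1 by rewrite oE// eqxx.
have XE (j : 'I_n) : (0 < j)%N -> g p (X p) (E j p) = 0.
  by move=> j0; rewrite -(E0 p hp) oE// -val_eqE/= eq_sym (gtn_eqF j0).
have le_j (j : 'I_n) (j0 : (0 < j)%N) :=
  hRD4_le hg hnabla hO hE sU hc secX (secE j) hp (hX1 p) (EE j) (XE j j0).
apply: (le_trans (ler_sum _ le_j)).
(* The trace of [B] over [D], that is, n H; subtracting B(X, X) leaves the sum
   over j >= 2. *)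
pose T : vect M := \sum_(i < n) B (E i) (E i).
have tT : tangent p T by apply: tangent_sum => i; apply: tB.
have TE : T = n%:R *: meanH g nabla D E p.
  by rewrite /meanH scalerA divff ?scale1r// pnatr_eq0 -lt0n.
have tH : tangent p (meanH g nabla D E p) by apply: tangentZ; exact: tT.
have tX2 := tB _ _ sX sX.
have tU := sU.1 p hp.
have gT : g p T T = n%:R ^+ 2 * g p (meanH g nabla D E p) (meanH g nabla D E p).
  rewrite TE (metricZl hg) ?(metricZr hg)//; last exact: tangentZ.
  by rewrite mulrA -expr2.
have wT : n%:R * omega g U p (meanH g nabla D E p) =
    omega g U p (B X X) + \sum_(j < n | (0 < j)%N) omega g U p (B (E j) (E j)).
  rewrite -[LHS](metricZr hg)// -TE (metric_sumr hg)//; last by move=> i; apply: tB.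
  by rewrite split0 B0.
have gB : \sum_(j < n | (0 < j)%N) g p (B (E j) (E j)) (B X X) =
    g p (T - B X X) (B X X).
  rewrite (metricBl hg)// (metric_suml hg)//; last by move=> i; apply: tB.
  by rewrite split0 B0 addrC addKr.
have lE : lambda1 g nabla U E p = alpha1 g nabla U X X p +
    \sum_(j < n | (0 < j)%N) alpha1 g nabla U (E j) (E j) p.
  by rewrite /lambda1 split0 a0.
have cE : \sum_(j < n | (0 < j)%N) c = (n%:R - 1) * c.
  apply: (addrI c); rewrite -(split0 (fun=> c)) sumr_const card_ord -mulr_natl.
  ring.
have sumE (b N A al w : 'I_n -> R) :
    \sum_(j < n | (0 < j)%N) (c + b j + N j / 2 + A j - (al j + w j)) =
    (n%:R - 1) * c + \sum_(j < n | (0 < j)%N) b j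
    + (\sum_(j < n | (0 < j)%N) N j) / 2 + \sum_(j < n | (0 < j)%N) A j
    - (\sum_(j < n | (0 < j)%N) al j + \sum_(j < n | (0 < j)%N) w j).
  by rewrite !big_split/= sumrN big_split/= mulr_suml cE.
rewrite sumE [X in _ + X + _ / 2]gB lE wT /AD /normBX2.
have := metric_split_le hg tT tX2; rewrite gT.
rewrite -/(B X X) => le4.
lra.
Qed.
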